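(* Let $f,g:\mathbb{C}\to\mathbb{C}$ be transcendental entire functions that are permutable, i.e. $f(g(z))=g(f(z))$ for all $z\in\mathbb{C}$. Then each of the three sets $BU(f\circ g)$, $K(f\circ g)$ and $I(f\circ g)$ is completely invariant under both $f$ and $g$.
   Context: For an entire function $h$, $h^n$ denotes the $n$-th iterate of $h$. The escaping set is $I(h)=\{z\in\mathbb{C}: |h^n(z)|\to\infty \text{ as } n\to\infty\}$. The filled Julia set is $K(h)=\{z\in\mathbb{C}: \text{the sequence } (h^n(z))_{n\in\mathbb{N}} \text{ is bounded}\}$. The bungee set is $BU(h)=\mathbb{C}\setminus (I(h)\cup K(h))$; equivalently, $z\in BU(h)$ if and only if there are sequences $m_k,n_k\to\infty$ and a constant $R>0$ such that $|h^{m_k}(z)|\le R$ for all $k$ and $|h^{n_k}(z)|\to\infty$ as $k\to\infty$. A set $S\subset\mathbb{C}$ is completely invariant under an entire function $h$ if, for every $z\in\mathbb{C}$, $z\in S$ if and only if $h(z)\in S$. An entire function is transcendental if it is not a polynomial. *)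

(* Defs.v *)
From HB Require Import structures.
From mathcomp Require Import all_boot all_order all_algebra.
From mathcomp Require Import complex.
From mathcomp Require Import all_classical all_reals all_analysis.
Set Implicit Arguments.
Unset Strict Implicit.
Unset Printing Implicit Defensive.
Import Order.TTheory GRing.Theory Num.Theory.
Import numFieldNormedType.Exports.
Local Open Scope classical_set_scope.
Local Open Scope ring_scope.
Local Open Scope complex_scope.

(* [R[i]] itself carries no topology in the libraries; its regular module
   [R[i]^o] is a normed module over the numFieldType [R[i]], with the topology
   of the modulus.  The norm [`|z|] takes its values in [R[i]] (it is a
   nonnegative real element), so the filter [+oo] below is that of [R[i]]: its
   basis is given by the sets of [x] with [M < x], which forces [x] to be
   real, for [M] real. *)
Notation cplx R := (R[i]^o) (only parsing).

(* The scalar field is [R[i]], hence this limit of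
   [h^-1 *: (f (h + z) - f z)] is over complex [h]. *)
Definition entire (R : realType) (f : cplx R -> cplx R) : Prop :=
  forall z : cplx R, derivable f z 1.

Definition transcendental_entire (R : realType) (f : cplx R -> cplx R) : Prop :=
  entire f /\ ~ exists p : {poly R[i]}, forall z : R[i], f z = p.[z].

Definition permutable (R : realType) (f g : cplx R -> cplx R) : Prop :=
  forall z : cplx R, f (g z) = g (f z).

Definition escaping_set (R : realType) (h : cplx R -> cplx R) : set (cplx R) :=
  [set z | `|iter n h z| @[n --> \oo] --> +oo].

Definition filled_julia_set (R : realType) (h : cplx R -> cplx R) :
    set (cplx R) :=
  [set z | bounded_fun (fun n : nat => iter n h z)].

Definition bungee_set (R : realType) (h : cplx R -> cplx R) : set (cplx R) :=
  ~` (escaping_set h `|` filled_julia_set h).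

Definition completely_invariant (R : realType) (S : set (cplx R))
    (h : cplx R -> cplx R) : Prop :=
  forall z : cplx R, S z <-> S (h z).

(* Main.v *)
(* Let [h := f \o g] and [u n := h^n z].  By permutability [h^n (f z) = f (u n)]
   and [u n.+1 = g (f (u n))].  Entire functions are bounded on bounded sets, so
   applying one preserves boundedness of sequences and reflects escape; with
   [f] and [g] this gives both directions for [K(h)] and [I(h)], and [BU(h)] is
   the complement of their union. *)
Require Import Defs.
From HB Require Import structures.
From mathcomp Require Import all_boot all_order all_algebra.
From mathcomp Require Import complex.
From mathcomp Require Import all_classical all_reals all_analysis.
Import Order.TTheory GRing.Theory Num.Theory.
Import numFieldNormedType.Exports.
Local Open Scope classical_set_scope.
Local Open Scope ring_scope.
Local Open Scope complex_scope.

Section Entire.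
Context {R : realType}.
Implicit Types (f : cplx R -> cplx R) (u : nat -> cplx R).

Lemma normc_le_norm_Re_Im (x y : R) : `|x +i* y| <= (`|x| + `|y|)%:C.
Proof.
rewrite normc_def lecR /= -[leRHS]ger0_norm ?addr_ge0// -sqrtr_sqr ler_wsqrtr//.
by rewrite sqrrD !real_normK ?num_real// lerD2r lerDl mulrn_wge0 ?mulr_ge0.
Qed.

Lemma normc_ge_Im (z : R[i]) : `|complex.Im z|%:C <= `|z|.
Proof. by rewrite normc_def lecR -sqrtr_sqr ler_wsqrtr// lerDr sqr_ge0. Qed.

(** This allows a map on [R[i]] to be read as a map of two real variables. Since the modulus is at
    most the sum of the two coordinate moduli, half of the tolerance goes to each coordinate. *)
Lemma continuous_of_Re_Im : continuous (fun p : R * R => (p.1 +i* p.2 : cplx R)).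
Proof.
move=> p; apply/cvgrPdist_lt => e e0.
have /complex_realP[r er] := gtr0_real e0.
move: e0; rewrite er ltcR => r0; near=> q.
have q1 : `|p.1 - q.1| < r / 2.
  near: q; apply: (@cvgr_dist_lt _ _ _ _ _ fst); first exact: cvg_fst.
  by rewrite divr_gt0.
have q2 : `|p.2 - q.2| < r / 2.
  near: q; apply: (@cvgr_dist_lt _ _ _ _ _ snd); first exact: cvg_snd.
  by rewrite divr_gt0.
apply: (le_lt_trans (normc_le_norm_Re_Im (p.1 - q.1) (p.2 - q.2))).
by rewrite ltcR [ltRHS]splitr ltrD.
Unshelve. all: by end_near. Qed.

Lemma entire_continuous f : entire f -> continuous f.
Proof.
by move=> ef z; apply: differentiable_continuous; apply/derivable1_diffP.
Qed.

(* [compact_bounded] is stated over a realType only, hence the passage to the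
   real-valued modulus on a square of [R * R]. *)
Lemma entire_disk_bounded f (M : R[i]) : entire f ->
  exists B : R, forall z : cplx R, `|z| <= M -> `|f z| <= B%:C.
Proof.
move=> /entire_continuous cf.
pose F (p : R * R) : R := complex.Re `|f (p.1 +i* p.2)|.
have FE p : (F p)%:C = `|f (p.1 +i* p.2)| by rewrite RRe_real ?normr_real.
have cF : continuous F.
  move=> p; apply/cvgrPdist_lt => e e0.
  have : (f (q.1 +i* q.2) : cplx R) @[q --> p] --> f (p.1 +i* p.2).
    by apply: (continuous_comp (@continuous_of_Re_Im p)); exact: cf.
  move=> /cvgrPdist_lt/(_ e%:C); rewrite ltcR => /(_ e0).
  apply: filterS => q; rewrite -ltcR; apply: le_lt_trans.
  (* By the reverse triangle inequality, passing to the modulus does not increase distances. *)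
  apply: le_trans (ler_dist_dist _ _); rewrite -!FE -rmorphB /=.
  by rewrite [leRHS]normc_def /= expr0n addr0 sqrtr_sqr.
pose r := complex.Re M.
have cK : compact (`[- r, r] `*` `[- r, r]).
  by apply: compact_setX; apply: segment_compact.
have [B [_ FB]] := compact_bounded (continuous_compact (continuous_subspaceT cF) cK).
(* Compactness bounds [F] on the square by every number strictly above [B], hence the added 1. *)
exists (B + 1) => z zM.
(* The order of [R[i]] makes anything above the nonnegative [|z|] real; for a non-real [M] no such
   [z] exists. *)
have Mr : r%:C = M.
  by rewrite RRe_real// ger0_real// (le_trans _ zM).
case: z zM => x y zM; rewrite -[f _]/(f ((x, y).1 +i* (x, y).2)) -FE lecR.
apply: le_trans (ler_norm _) _.
apply: (FB (B + 1)); first by rewrite ltrDl.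
exists (x, y) => //=.
rewrite !in_itv /= -!ler_norml -2!lecR Mr.
by rewrite !(le_trans _ zM) ?(normc_ge_Re (x +i* y)) ?(normc_ge_Im (x +i* y)).
Qed.

Lemma bounded_seqP u : bounded_fun u <-> exists M, forall n, `|u n| <= M.
Proof.
have FF : ProperFilter (globally [set: nat]) by exact: (globally_properfilter (a := 0%N)).
split=> [/ex_bound[M uM]|[M uM]]; first by exists M => n; exact: uM.
by apply/ex_bound; exists M => n _; exact: uM.
Qed.

Lemma entire_bounded_fun f u : entire f -> bounded_fun u -> bounded_fun (f \o u).
Proof.
move=> ef /bounded_seqP[M uM]; have [B fB] := entire_disk_bounded f M ef.
by apply/bounded_seqP; exists B%:C => n; apply: fB; apply: uM.
Qed.

(** Contrapositive of boundedness on disks: if [B] bounds [f] on the disk of radius [M], then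
    [|f (u n)|] above [B] forces [|u n|] above [M]. *)
Lemma entire_escape f u : entire f ->
  `|f (u n)| @[n --> \oo] --> +oo -> `|u n| @[n --> \oo] --> +oo.
Proof.
move=> ef /cvgryPgtr fu; apply/cvgryPgtr => M Mr.
have [B fB] := entire_disk_bounded f M ef.
have Br : B%:C \is Num.real by apply/complex_realP; exists B.
move: (fu _ Br); apply: filterS => n.
rewrite !real_ltNge ?normr_real//; apply: contra; exact: fB.
Qed.

End Entire.

Section CompletelyInvariant.
Context {R : realType}.
Implicit Types (f g h : cplx R -> cplx R).

Lemma iter_permutable f h n z : permutable f h ->
  iter n h (f z) = f (iter n h z).
Proof. by move=> fh; elim: n => //= n ->; rewrite -fh. Qed.

(** The factorization of [h] is pointwise so that the lemma serves both factors of [f \o g], in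
    either order of composition. *)
Lemma completely_invariant_filled_julia_set f g h : entire f -> entire g ->
  permutable f h -> h =1 g \o f -> completely_invariant (filled_julia_set h) f.
Proof.
move=> ef eg fh hE z; rewrite /filled_julia_set /=.
rewrite (funext (fun n => iter_permutable f h n z fh)).
split=> [|/(entire_bounded_fun _ _ eg)]; first exact: entire_bounded_fun.
(* [M] bounds only the terms of the orbit from index 1 on; [|z|] accounts for the initial one. *)
move=> /bounded_seqP[M zM]; apply/bounded_seqP; exists (`|z| + M).
have M0 : 0 <= M by rewrite (le_trans _ (zM 0)).
by case=> [|n] /=; [rewrite lerDl|rewrite hE (le_trans (zM n))// lerDr].
Qed.

Lemma completely_invariant_escaping_set f g h : entire f -> entire g ->
  permutable f h -> h =1 g \o f -> completely_invariant (escaping_set h) f.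
Proof.
move=> ef eg fh hE z; rewrite /escaping_set /=.
rewrite [X in _ <-> X](eq_cvg _ _ (fun n => congr1 _ (iter_permutable f h n z fh))).
(* The forward direction reflects escape through [g], from the shifted orbit [g (f (u n))] back to
   [f (u n)]; the converse reflects it through [f]. *)
split=> [zoo|]; last exact: entire_escape.
apply: (entire_escape _ _ eg).
under eq_fun do rewrite -[g _]hE.
exact: (cvg_comp S (fun n => `|iter n h z|) (cvg_addnl 1) zoo).
Qed.

Lemma completely_invariant_bungee_set f h :
  completely_invariant (escaping_set h) f ->
  completely_invariant (filled_julia_set h) f ->
  completely_invariant (bungee_set h) f.
Proof. by move=> hI hK z; rewrite /bungee_set /= /setC /setU /= -hI -hK. Qed.

End CompletelyInvariant.

Theorem corollary3p36 (R : realType) (f g : cplx R -> cplx R)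
    (hf : transcendental_entire f) (hg : transcendental_entire g)
    (hfg : permutable f g) :
  (completely_invariant (bungee_set (f \o g)) f /\
   completely_invariant (bungee_set (f \o g)) g) /\
  (completely_invariant (filled_julia_set (f \o g)) f /\
   completely_invariant (filled_julia_set (f \o g)) g) /\
  (completely_invariant (escaping_set (f \o g)) f /\
   completely_invariant (escaping_set (f \o g)) g).
Proof.
have [[ef _] [eg _]] := (hf, hg).
have fh : permutable f (f \o g) by move=> z; rewrite /= hfg.
have gh : permutable g (f \o g) by move=> z; rewrite /= [RHS]hfg.
have Kf := completely_invariant_filled_julia_set f g _ ef eg fh hfg.
have Kg := completely_invariant_filled_julia_set g f _ eg ef gh (frefl _).
have If := completely_invariant_escaping_set f g _ ef eg fh hfg.
have Ig := completely_invariant_escaping_set g f _ eg ef gh (frefl _).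
split; last by split; split.
by split; [exact: completely_invariant_bungee_set If Kf
          |exact: completely_invariant_bungee_set Ig Kg].
Qed.
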